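(* Let $\underline{A},\overline{A}\in\mathbb{R}^{n\times n}$ with $\underline{A}\le\overline{A}$ (entrywise) and let $\mathbf{A}=\{A\in\mathbb{R}^{n\times n} : \underline{A}\le A\le\overline{A}\}$. Then $\mathbf{A}$ is strongly copositive if and only if $\underline{A}$ is copositive; and $\mathbf{A}$ is strongly strictly copositive if and only if $\underline{A}$ is strictly copositive.
   Context: All inequalities between vectors or matrices are entrywise. A matrix property holds strongly for an interval matrix $\mathbf{A}$ if it holds for every $A\in\mathbf{A}$. A matrix $A\in\mathbb{R}^{n\times n}$ (not necessarily symmetric) is copositive if $x^TAx\ge 0$ for each $x\ge 0$; it is strictly copositive if $x^TAx>0$ for each $x\ge 0$, $x\ne 0$. *)

(* Defs.v *)
From HB Require Import structures.
From mathcomp Require Import all_boot all_order all_algebra.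
From mathcomp Require Import classical_sets reals.

Set Implicit Arguments.
Unset Strict Implicit.
Unset Printing Implicit Defensive.

Import Order.TTheory GRing.Theory Num.Theory.

Local Open Scope classical_set_scope.
Local Open Scope ring_scope.

Definition mxle (R : realType) (m n : nat) (A B : 'M[R]_(m, n)) : Prop :=
  forall i j, A i j <= B i j.

Definition interval_mx (R : realType) (m n : nat) (Al Au : 'M[R]_(m, n)) :
    set 'M[R]_(m, n) :=
  [set A | mxle Al A /\ mxle A Au].

Definition strongly (R : realType) (m n : nat) (P : 'M[R]_(m, n) -> Prop)
    (IA : set 'M[R]_(m, n)) : Prop :=
  forall A, IA A -> P A.

(* The value x^T A x as a scalar: the only entry of a 1 x 1 matrix. *)
Definition quad_form (R : realType) (n : nat) (A : 'M[R]_n) (x : 'cV[R]_n) : R :=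
  (x^T *m A *m x) 0 0.

(* Symmetry of A is not required, here and in strictly_copositive. *)
Definition copositive (R : realType) (n : nat) (A : 'M[R]_n) : Prop :=
  forall x : 'cV[R]_n, mxle 0 x -> 0 <= quad_form A x.

Definition strictly_copositive (R : realType) (n : nat) (A : 'M[R]_n) : Prop :=
  forall x : 'cV[R]_n, mxle 0 x -> x <> 0 -> 0 < quad_form A x.

(* Main.v *)
Require Import Defs.
From mathcomp Require Import all_boot all_order all_algebra.
From mathcomp Require Import classical_sets reals.

Import Order.TTheory GRing.Theory Num.Theory.
Local Open Scope ring_scope.

(** For fixed [x >= 0], the form is a sum of entries of the matrix with nonnegative weights
    [x i 0 * x j 0], hence monotone in the matrix ([le_quad_form]). So [Al] gives the least value
    over the interval, and a lower bound there, strict or not, passes to every member. Conversely,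
    [Al] is itself a member. *)

Lemma mxle_refl (R : realType) (m n : nat) (A : 'M[R]_(m, n)) : mxle A A.
Proof. by move=> i j; apply: lexx. Qed.

(** Exposes the monomials, so that two forms can be compared entry by entry. *)
Lemma quad_formE (R : realType) (n : nat) (A : 'M[R]_n) (x : 'cV[R]_n) :
  quad_form A x = \sum_j \sum_i x i 0 * A i j * x j 0.
Proof.
rewrite /quad_form mxE; apply: eq_bigr => j _.
by rewrite mxE mulr_suml; apply: eq_bigr => i _; rewrite mxE.
Qed.

Lemma le_quad_form (R : realType) (n : nat) (A B : 'M[R]_n) (x : 'cV[R]_n) :
  mxle A B -> mxle 0 x -> quad_form A x <= quad_form B x.
Proof.
move=> leAB x_ge0; have xi_ge0 i : 0 <= x i 0 by have := x_ge0 i 0; rewrite mxE.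
rewrite !quad_formE; apply: ler_sum => j _; apply: ler_sum => i _.
by apply: ler_wpM2r => //; apply: ler_wpM2l.
Qed.

Theorem proposition3 (R : realType) (n : nat) (Al Au : 'M[R]_n)
    (hA : mxle Al Au) :
  (strongly (@copositive R n) (interval_mx Al Au) <-> copositive Al) /\
  (strongly (@strictly_copositive R n) (interval_mx Al Au) <->
   strictly_copositive Al).
Proof.
have Al_in : interval_mx Al Au Al by split => //; apply: mxle_refl.
(* Both forward implications are instances at [Al], by [Al_in]; the two converses remain. *)
split; split; try by apply.
- move=> copA A [leA _] x x_ge0.
  exact: le_trans (copA x x_ge0) (le_quad_form _ _ _ _ _ leA x_ge0).
- move=> copA A [leA _] x x_ge0 x_neq0.
  exact: lt_le_trans (copA x x_ge0 x_neq0) (le_quad_form _ _ _ _ _ leA x_ge0).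
Qed.
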